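(* Each word-representable graph $G$ on $n\ge 3$ vertices is $2(n-2)$-word-representable.
   Context: Graphs are finite, simple and undirected. Two distinct letters $x,y$ alternate in a word $W$ if the word obtained from $W$ by deleting all letters other than $x$ and $y$ contains neither $xx$ nor $yy$ as a factor (two consecutive letters). A word $W$ represents a graph $G=(V,E)$ if the set of letters occurring in $W$ is $V$ (every vertex occurs at least once) and, for all distinct $x,y\in V$, $xy\in E$ if and only if $x$ and $y$ alternate in $W$. $G$ is word-representable if some word represents it. A word is $k$-uniform if each of its letters occurs in it exactly $k$ times. $G$ is $k$-word-representable if some $k$-uniform word represents it. *)

(* Defs.v *)
From mathcomp Require Import all_boot.

Set Implicit Arguments.
Unset Strict Implicit.
Unset Printing Implicit Defensive.

(* A finite simple graph is a symmetric irreflexive relation on a finType;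
   words over its vertex set V are elements of seq V.  In mathcomp,
   [infix u w] says that u is a block of consecutive letters of w. *)

Definition alternate (V : eqType) (x y : V) (W : seq V) : bool :=
  let Wxy := [seq z <- W | (z == x) || (z == y)] in
  ~~ infix [:: x; x] Wxy && ~~ infix [:: y; y] Wxy.

(* Letters of a word in seq V are vertices by typing, so the first clause says
   that the set of letters of W is exactly V. *)
Definition represents (V : finType) (E : rel V) (W : seq V) : Prop :=
  (forall x : V, x \in W) /\
  (forall x y : V, x != y -> (E x y <-> alternate x y W)).

Definition word_representable (V : finType) (E : rel V) : Prop :=
  exists W : seq V, represents E W.

Definition uniform_word (V : eqType) (k : nat) (W : seq V) : Prop :=
  forall x : V, x \in W -> count_mem x W = k.

Definition k_word_representable (V : finType) (k : nat) (E : rel V) : Prop :=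
  exists W : seq V, uniform_word k W /\ represents E W.

(* Main.v *)
Require Import Defs.
From mathcomp Require Import all_boot.
From mathcomp Require Import zify.

(** A word representing G orients it: send an edge towards the endpoint whose
    first occurrence comes later.  For an arc x -> y, every prefix of the word
    contains as many x as y, or one more ([leads]).  These inequalities add up
    along directed paths, so if x -> z is an arc and y lies on a directed path
    from x to z, then y must alternate with both ends.  Hence the orientation,
    acyclic by construction, has no shortcuts ([represents_orientation]).

    Conversely, let D be an acyclic shortcut-free orientation of G and v a
    vertex.  Let I and O be the in- and out-neighbours of v, A and B the
    remaining vertices that reach v and that v reaches, and T all the others.
    With each class listed in topological order, consider the 2-uniform word

        A I T A v O I v B T O B          ([center_word]).

    Absence of shortcuts forbids arcs from I to A, from A to O, from O to any
    class but O and B, and so on ([region_compatible]).  For each arc x -> y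
    that remains possible, the word restricts to x y x y
    ([center_word_arc]), whereas v alternates with no vertex outside I and O
    ([center_word_nonadjacent]).

    Blocks x y x y still alternate when concatenated, and a violation inside
    one factor survives concatenation.  So the words of the vertices in a set
    S can be concatenated into a word representing G as soon as every
    non-adjacent pair meets S ([flatten_center_words]).  If a b is an edge,
    the complement of {a, b} is such a set, of size n - 2, and the result is
    2(n - 2)-uniform.  If there is no edge, a word a..ab..b.. repeating each
    letter at least twice in a row represents G. *)

Set Implicit Arguments.
Unset Strict Implicit.
Unset Printing Implicit Defensive.

(** * Alternation as a bound on prefix counts *)

Definition restrict (V : eqType) (x y : V) (W : seq V) : seq V :=
  [seq z <- W | (z == x) || (z == y)].

Definition distinct (V : eqType) : rel V := fun x y => x != y.

Lemma restrictC (V : eqType) (x y : V) (W : seq V) :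
  restrict x y W = restrict y x W.
Proof. by apply: eq_filter => z; rewrite orbC. Qed.

Lemma alternateC (V : eqType) (x y : V) (W : seq V) :
  alternate x y W = alternate y x W.
Proof. by rewrite /alternate -!/(restrict _ _ _) restrictC andbC. Qed.

Lemma alternate_sorted (V : eqType) (x y : V) (W : seq V) :
  alternate x y W = sorted (@distinct V) (restrict x y W).
Proof.
rewrite /alternate -/(restrict x y W).
have : all (fun z => (z == x) || (z == y)) (restrict x y W) by apply: filter_all.
elim: (restrict x y W) => [|a [|b F] IH] //; first by rewrite /= !andbF.
case/andP=> a_xy bF_xy; move: IH => /(_ bF_xy) IH.
have infix2 c : ~~ infix [:: c; c] [:: a, b & F]
    = ~~ ((c == a) && (c == b)) && ~~ infix [:: c; c] (b :: F).
  by rewrite infix_consl !prefix_cons prefix0s andbT negb_or.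
rewrite (infix2 x) (infix2 y) andbACA IH /= {1}/distinct; congr (_ && _).
case/andP: bF_xy => b_xy _.
case: (eqVneq x a) a_xy => [<-|nxa] /=.
  case: (eqVneq y x) => [->|nyx] //=; first by rewrite andbb.
  by rewrite andbT.
by move=> /eqP <-; rewrite eqxx.
Qed.

(** This says that x and y alternate in W with x first, in a form that can be
    chained: the inequalities between counts are transitive even though
    alternation is not. *)
Definition leads (V : eqType) (x y : V) (W : seq V) : Prop :=
  forall k, count_mem y (take k W) <= count_mem x (take k W)
              <= (count_mem y (take k W)).+1.

(** The extra head y of the path forbids y as a first letter.  Deleting a
    leading x exchanges the roles of x and y on both sides, which is why the
    induction quantifies over x and y. *)
Lemma leadsP (V : eqType) (x y : V) (W : seq V) :
  x != y -> leads x y W <-> path (@distinct V) y (restrict x y W).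
Proof.
elim: W x y => [|z W IH] x y nxy; first by split=> // _ [|k].
rewrite /restrict /= -/(restrict x y W).
case: (eqVneq z x) => [->|nzx] /=.
  rewrite {1}/distinct eq_sym nxy /= restrictC -IH 1?eq_sym //.
  split=> L k.
    by have := L k.+1; rewrite /= eqxx (negbTE nxy); lia.
  by case: k => [|k] //=; have := L k; rewrite eqxx (negbTE nxy); lia.
case: (eqVneq z y) => [->|nzy] /=.
  rewrite {1}/distinct eqxx; split=> // /(_ 1).
  by rewrite /= take0 eqxx eq_sym (negbTE nxy).
rewrite -IH //; split=> L k.
  by have := L k.+1; rewrite /= (negbTE nzx) (negbTE nzy).
by case: k => [|k] //=; rewrite (negbTE nzx) (negbTE nzy); apply: L.
Qed.

Lemma alternate_leads (V : eqType) (x y : V) (W : seq V) :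
  x != y -> alternate x y W <-> leads x y W \/ leads y x W.
Proof.
move=> nxy; have nyx : y != x by rewrite eq_sym.
rewrite alternate_sorted !leadsP // (restrictC y x).
split=> [|[]]; try exact: path_sorted.
have := filter_all (fun z => (z == x) || (z == y)) W; rewrite -/(restrict x y W).
case: (restrict x y W) => [|a F] /=; first by left.
by case/andP=> /orP[]/eqP -> _ ->; rewrite /distinct ?nxy ?nyx; [left|right].
Qed.

Lemma leads_index (V : eqType) (x y : V) (W : seq V) :
  x != y -> y \in W -> leads x y W -> index x W < index y W.
Proof.
move=> nxy yW /(_ (index y W).+1) /andP[le_yx _].
have : x \in take (index y W).+1 W.
  rewrite -has_pred1 has_count; apply: leq_trans le_yx.
  by rewrite -has_count has_pred1 in_take // leqnn.
have [xW|/negP nW /mem_take //] := boolP (x \in W).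
rewrite in_take // ltnS leq_eqVlt => /orP[/eqP eq_ix|//].
by rewrite -(nth_index x xW) eq_ix (nth_index x yW) eqxx in nxy.
Qed.

(** * The orientation induced by a word *)

(** A three-vertex form of semi-transitivity: instead of asking that all pairs
    on a directed path from x to z be adjacent, it compares one vertex y of
    the path with the two ends. *)
Definition shortcut_free (V : finType) (D : rel V) : Prop :=
  forall x y z, D x z -> connect D x y -> connect D y z ->
    (x != y -> D x y) /\ (y != z -> D y z).

(** Acyclicity enters only through the existence of such a list. *)
Definition topological_order (V : finType) (D : rel V) (s : seq V) : Prop :=
  [/\ uniq s, forall x, x \in s & forall x y, D x y -> index x s < index y s].

(** If y lies on a path from x to z then #z <= #y <= #x in every prefix, and
    the arc x -> z gives #x <= #z + 1; so #x, #y and #z always lie within one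
    of each other, in this order.  First occurrences increase along arcs, so
    sorting by them gives the topological order. *)
Lemma represents_orientation (V : finType) (E : rel V) (W : seq V) :
    irreflexive E -> represents E W ->
  exists D : rel V, exists s : seq V,
    [/\ forall x y, E x y = D x y || D y x,
        shortcut_free D & topological_order D s].
Proof.
move=> E_irr [W_all W_E].
pose D x y := (x != y) && path (@distinct V) y (restrict x y W).
have DP x y : D x y -> x != y /\ leads x y W.
  by case/andP=> nxy /(leadsP _ nxy).
have D_leads x y : x != y -> leads x y W -> D x y.
  by move=> nxy /(leadsP _ nxy) xy; rewrite /D nxy xy.
have D_index x y : D x y -> index x W < index y W.
  by case/DP=> nxy; apply: leads_index.
have path_count x y k : connect D x y ->
    count_mem y (take k W) <= count_mem x (take k W).
  case/connectP=> p; elim: p x => [x _ -> //|z p IH x /= /andP[xz zp] yE].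
  by apply: leq_trans (IH z zp yE) _; case/DP: xz => _ /(_ k)/andP[].
exists D, (sort (relpre (index^~ W) leq) (enum V)); split.
- move=> x y; have [->|nxy] := eqVneq x y; first by rewrite E_irr /D eqxx.
  apply/idP/orP=> [/W_E|xy]; last apply/W_E => //.
    case/(_ nxy)/alternate_leads => // L; [left|right]; apply: D_leads => //.
    by rewrite eq_sym.
  by apply/alternate_leads => //; case: xy => /DP[_ L]; [left|right].
- move=> x y z /DP[_ xz] xy yz; split=> ne; apply: D_leads => // k;
    have /andP[_ le_xz] := xz k; have le_yx := path_count _ _ k xy;
    have le_zy := path_count _ _ k yz; apply/andP; split=> //.
    by apply: (leq_trans le_xz); rewrite ltnS.
  by apply: leq_trans le_xz.
split=> [|x|x y xy]; first by rewrite sort_uniq enum_uniq.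
  by rewrite mem_sort mem_enum.
set s := sort _ _; have s_all z : z \in s by rewrite mem_sort mem_enum.
have s_sorted : sorted (relpre (index^~ W) leq) s.
  by apply: sort_sorted => u v; apply: leq_total.
rewrite ltnNge leq_eqVlt; apply/negP=> /orP[/eqP eq_i|].
  case/DP: xy => /negP[]; apply/eqP.
  by rewrite -(nth_index x (s_all x)) -eq_i nth_index.
have le_tr : transitive (relpre (index^~ W) leq) by move=> u v w; apply: leq_trans.
move/(sorted_ltn_index le_tr s_sorted) => /(_ (s_all y) (s_all x)) /=.
by rewrite leqNgt D_index.
Qed.

Lemma connect_index (V : finType) (D : rel V) (s : seq V) (x y : V) :
  topological_order D s -> connect D x y -> index x s <= index y s.
Proof.
case=> _ _ s_D /connectP[p]; elim: p x => [x _ -> //|z p IH x /= /andP[xz zp] yE].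
exact: leq_trans (ltnW (s_D _ _ xz)) (IH z zp yE).
Qed.

Lemma restrict_uniq (V : eqType) (x y : V) (s : seq V) :
    uniq s -> x \in s -> y \in s -> index x s < index y s ->
  restrict x y s = [:: x; y].
Proof.
elim: s => //= z s IH /andP[zs s_uniq]; rewrite !inE /restrict /=.
have [<-|_] := eqVneq z x; have [<-|_] //= := eqVneq z y.
  move=> _ ys _; congr (_ :: _).
  rewrite -(filter_pred1_uniq s_uniq ys); apply: eq_in_filter => u us /=.
  by case: eqVneq => // uz; rewrite -uz us in zs.
by rewrite ltnS; apply: IH.
Qed.

(** * The word centred at a vertex *)

(** [In] and [Out] are the neighbours of the centre, [Before] and [After] its
    non-adjacent ancestors and descendants, [Aside] everything else. *)
Variant region := Center | In | Out | Before | After | Aside.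
Scheme Boolean Equality for region.

Definition region_of (V : finType) (D : rel V) (v u : V) : region :=
  if u == v then Center
  else if connect D u v then if D u v then In else Before
  else if connect D v u then if D v u then Out else After
  else Aside.

(** The two occurrences of the centre have [In] before and between them and
    [Out] between and after them, while both occurrences of [Before] precede
    them, both of [After] follow them, and those of [Aside] enclose them.  The
    rest of the order makes all [compatible] pairs of classes interleave. *)
Definition schedule : seq region :=
  [:: Before; In; Aside; Before; Center; Out; In; Center; After; Aside; Out; After].

Definition center_word (V : finType) (D : rel V) (s : seq V) (v : V) : seq V :=
  flatten [seq [seq u <- s | region_beq (region_of D v u) r] | r <- schedule].

Lemma restrict_center_word (V : finType) (D : rel V) (s : seq V) (v x y : V) :
  restrict x y (center_word D s v) = center_word D (restrict x y s) v.
Proof.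
rewrite /restrict /center_word filter_flatten -map_comp; congr flatten.
apply: eq_map => r /=; rewrite -!filter_predI; apply: eq_filter => u /=.
by rewrite andbC.
Qed.

Lemma count_center_word (V : finType) (D : rel V) (s : seq V) (v x : V) :
  uniq s -> x \in s -> count_mem x (center_word D s v) = 2.
Proof.
move=> s_uniq xs.
have count_block r : count_mem x [seq u <- s | region_beq (region_of D v u) r]
                     = region_beq (region_of D v x) r.
  by rewrite count_uniq_mem ?filter_uniq // mem_filter xs andbT.
rewrite /center_word /= !count_cat !count_block.
by case: (region_of D v x).
Qed.

(** The pairs of regions that an arc can join; distinct compatible regions
    r1 and r2 occur in [schedule] in the order r1, r2, r1, r2. *)
Definition compatible (r1 r2 : region) : bool :=
  match r1, r2 with
  | Before, (Before | In | Aside) | In, (In | Center | Out | Aside)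
  | Aside, (Aside | Out | After) | Center, Out
  | Out, (Out | After) | After, After => true
  | _, _ => false
  end.

(** An arc x -> y outside the table closes a cycle, or puts x or y in a
    region closer to v because it is reached from v or reaches v along the
    arc, or else creates a shortcut: the arc itself around v when x reaches v
    and v reaches y ([across]), the arc x -> v around y when y reaches v
    ([enter]), or the arc v -> y around x when v reaches x ([leave]). *)
Lemma region_compatible (V : finType) (D : rel V) (s : seq V) (v x y : V) :
    shortcut_free D -> topological_order D s ->
  D x y -> compatible (region_of D v x) (region_of D v y).
Proof.
move=> D_sf D_top xy.
have no_cycle a b : D a b -> connect D b a = false.
  move=> ab; apply/negP=> /(connect_index D_top).
  by case: D_top => _ _ s_D; rewrite leqNgt s_D.
have DC a b : D a b ==> connect D a b by apply/implyP/connect1.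
have loopless a : D a a = false.
  by apply/negP=> aa; have := no_cycle _ _ aa; rewrite connect0.
rewrite /region_of; have [xv|xv] := eqVneq x v.
  rewrite xv in xy; have [yv|_] := eqVneq y v; first by rewrite yv loopless in xy.
  by rewrite (no_cycle _ _ xy) (connect1 xy) xy.
have [yv|yv] := eqVneq y v.
  by rewrite yv in xy; rewrite (connect1 xy) xy.
have to_v : connect D y v ==> connect D x v.
  by apply/implyP/connect_trans/connect1.
have from_v : connect D v x ==> connect D v y.
  by apply/implyP=> vx; apply: connect_trans vx (connect1 xy).
have not_both : ~~ (connect D y v && connect D v x).
  apply/negP=> /andP[yv_c vx_c].
  by have := connect_trans yv_c vx_c; rewrite no_cycle.
have across : connect D x v && connect D v y ==> D x v && D v y.
  apply/implyP=> /andP[xv_c vy_c]; have [-> //] := D_sf _ _ _ xy xv_c vy_c.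
  by rewrite eq_sym; apply.
have enter : D x v && connect D y v ==> D y v.
  apply/implyP=> /andP[xv_d yv_c].
  by have [_ ->] := D_sf _ _ _ xv_d (connect1 xy) yv_c.
have leave : D v y && connect D v x ==> D v x.
  apply/implyP=> /andP[vy_d vx_c].
  by have [->] := D_sf _ _ _ vy_d vx_c (connect1 xy); rewrite 1?eq_sym.
move: (DC x v) (DC v x) (DC y v) (DC v y) to_v from_v not_both across enter leave.
(* What remains is propositional in the four reachabilities and four arcs
   between v and the ends x, y. *)
case: (connect D x v) (connect D v x) (connect D y v) (connect D v y) => [] [] [] [] //=;
by case: (D x v); case: (D v x); case: (D y v); case: (D v y).
Qed.

(** Within one region x precedes y in both copies by topological order; across
    two regions the schedule interleaves them. *)
Lemma center_word_arc (V : finType) (D : rel V) (s : seq V) (v x y : V) :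
    shortcut_free D -> topological_order D s ->
  D x y -> restrict x y (center_word D s v) = [:: x; y; x; y].
Proof.
move=> D_sf D_top xy; have := region_compatible v D_sf D_top xy.
case: D_top => s_uniq s_all s_D.
rewrite restrict_center_word restrict_uniq ?s_D // /center_word /=.
by case: (region_of D v x); case: (region_of D v y).
Qed.

Lemma center_word_nonadjacent (V : finType) (D : rel V) (s : seq V) (v u : V) :
    topological_order D s -> u != v -> ~~ D u v -> ~~ D v u ->
  ~~ alternate v u (center_word D s v).
Proof.
move=> [s_uniq s_all _] uv nuv nvu; have vu : v != u by rewrite eq_sym.
rewrite alternate_sorted restrict_center_word.
have v_center : region_of D v v = Center by rewrite /region_of eqxx.
have u_far : match region_of D v u with
             | Before | After | Aside => true | _ => false end.
  rewrite /region_of (negbTE uv) (negbTE nuv) (negbTE nvu).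
  by case: (connect D u v); case: (connect D v u).
have [lt_vu|le_uv] := ltnP (index v s) (index u s).
  rewrite restrict_uniq // /center_word /= v_center.
  by move: u_far; case: (region_of D v u); rewrite //= /distinct ?eqxx ?andbF.
have lt_uv : index u s < index v s.
  rewrite ltn_neqAle le_uv andbT; apply: contra uv => /eqP eq_i.
  by rewrite -(nth_index v (s_all u)) eq_i nth_index.
rewrite restrictC restrict_uniq // /center_word /= v_center.
by move: u_far; case: (region_of D v u); rewrite //= /distinct ?eqxx ?andbF.
Qed.

Lemma alternate_infix (V : eqType) (x y : V) (W W' : seq V) :
  infix W' W -> alternate x y W -> alternate x y W'.
Proof.
case/infixP=> p [q ->]; rewrite !alternate_sorted /restrict !filter_cat.
by move/cat_sorted2=> [_ /cat_sorted2[]].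
Qed.

Lemma infix_flatten (T : eqType) (w : seq T) (ws : seq (seq T)) :
  w \in ws -> infix w (flatten ws).
Proof. by case/splitPr=> ws1 ws2; rewrite flatten_cat infix_catl ?prefix_infix ?prefix_prefix. Qed.

(** * Concatenation over a set meeting all non-adjacent pairs *)

(** Every arc restricts to copies of x y x y, so edges are kept; a
    non-adjacent pair is broken by the factor centred at either of its
    vertices. *)
Lemma flatten_center_words (V : finType) (E D : rel V) (s vs : seq V) :
    (forall x y, E x y = D x y || D y x) ->
    shortcut_free D -> topological_order D s -> 0 < size vs ->
    (forall x y, x != y -> ~~ E x y -> (x \in vs) || (y \in vs)) ->
  k_word_representable (2 * size vs) E.
Proof.
move=> E_D D_sf D_top vs_gt0 vs_cover.
pose W := flatten [seq center_word D s v | v <- vs].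
have W_count x : count_mem x W = 2 * size vs.
  have [s_uniq s_all _] := D_top.
  rewrite /W; elim: (vs) => //= v vs' IH.
  by rewrite count_cat count_center_word // IH mulnS.
have W_arc x y : D x y -> alternate x y W.
  move=> xy; have nxy : x != y.
    by have [_ _ s_D] := D_top; apply: contraTneq (s_D _ _ xy) => ->; rewrite ltnn.
  rewrite alternate_sorted.
  suff : path (@distinct V) y (restrict x y W) by apply: path_sorted.
  rewrite /W; elim: (vs) => //= v vs' IH.
  rewrite /restrict filter_cat -!/(restrict _ _ _) center_word_arc //= IH.
  by rewrite /distinct nxy eq_sym nxy.
have W_nonadjacent v u : v \in vs -> u != v -> ~~ E u v -> ~~ alternate v u W.
  move=> v_vs uv; rewrite E_D negb_or => /andP[nuv nvu].
  apply: contra (center_word_nonadjacent D_top uv nuv nvu).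
  by apply/alternate_infix/infix_flatten/map_f.
have E_sym x y : E x y = E y x by rewrite !E_D orbC.
exists W; split; first by move=> x _.
split=> [x|x y nxy].
  by rewrite -has_pred1 has_count W_count muln_gt0.
split=> [|alt_xy]; first by rewrite E_D => /orP[]/W_arc //; rewrite alternateC.
apply/negPn/negP=> nE; case/orP: (vs_cover _ _ nxy nE) => v_vs.
  by have := W_nonadjacent x y v_vs; rewrite alt_xy eq_sym nxy E_sym nE => /(_ isT isT).
by have := W_nonadjacent y x v_vs nxy nE; rewrite alternateC alt_xy.
Qed.

Lemma edgeless_representable (V : finType) (E : rel V) (k : nat) :
  1 < k -> (forall x y, ~~ E x y) -> k_word_representable k E.
Proof.
move=> k_gt1 noE; pose W := flatten [seq nseq k x | x <- enum V].
have W_block x : infix (nseq k x) W.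
  by apply/infix_flatten/map_f; rewrite mem_enum.
have W_count x : count_mem x W = k.
  have <- : k * count_mem x (enum V) = k.
    by rewrite count_uniq_mem ?enum_uniq // mem_enum muln1.
  rewrite /W; elim: (enum V) => [|y l IH]; first by rewrite muln0.
  by rewrite /= count_cat count_nseq IH /= mulnDr mulnC.
exists W; split; first by move=> x _.
split=> [x|x y nxy].
  by rewrite -has_pred1 has_count W_count ltnW.
split=> [|/(alternate_infix (W_block x))]; first by rewrite (negbTE (noE x y)).
(* The block of k >= 2 letters x already contains the factor xx. *)
case: k k_gt1 {W W_block W_count} => [|[|k]] //=.
by rewrite alternate_sorted /restrict /= eqxx /= /distinct eqxx.
Qed.

Theorem corollary1 (V : finType) (E : rel V)
  (E_sym : symmetric E) (E_irr : irreflexive E)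
  (n : nat) (n_card : #|V| = n) (n_ge3 : 3 <= n) :
  word_representable E -> k_word_representable (2 * (n - 2)) E.
Proof.
case=> W /(represents_orientation E_irr)[D [s [E_D D_sf D_top]]].
case: (pickP (fun e => E e.1 e.2)) => [[a b] /= ab|noE]; last first.
  apply: edgeless_representable => [|x y]; last by rewrite (noE (x, y)).
  by rewrite (@leq_mul 2 1 2) ?subn_gt0.
have nab : a != b by apply: contraTneq ab => ->; rewrite E_irr.
pose vs := enum (~: [set a; b]).
have vs_size : size vs = n - 2.
  by rewrite -cardE -n_card -(cardsC [set a; b]) cards2 nab addKn.
rewrite -vs_size; apply: (flatten_center_words E_D D_sf D_top).
  by rewrite vs_size subn_gt0.
move=> x y nxy; apply: contraR; rewrite !mem_enum !inE negb_or !negbK.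
case/andP=> /pred2P[]xE /pred2P[]yE; move: nxy; rewrite xE yE ?eqxx //.
by rewrite E_sym.
Qed.
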